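(* Let $M,N$ be $\mathrm{CAU}^-$ terms (regarded as $\mathrm{CAU}^-_\sigma$ terms). If $M\to^*_{\mathrm{CAU}^-}N$, then $M\to^*_{\mathrm{CAU}^-_\sigma}N$.
   Context: The calculus $\mathrm{CAU}^-_\sigma$ uses nameless (de Bruijn) syntax: Terms $M,N ::= 1 \mid \lambda.M \mid M\,N \mid \mathsf{let}(M,N) \mid !_q M \mid q \triangleright M \mid \iota(\vartheta) \mid M[s] \mid \mathrm{er}(M)$; Trails $q ::= \mathsf{r} \mid \mathsf{t}(q,q') \mid \mathsf{ba} \mid \mathsf{bb} \mid \mathsf{ti} \mid \mathsf{lam}(q) \mid \mathsf{app}(q,q') \mid \mathsf{let}(q,q') \mid \mathsf{tr}(\zeta) \mid \mathrm{tl}(M)$; Substitutions $s,t ::= \langle\rangle \mid {\uparrow} \mid M\cdot s \mid s\circ t$. Index $1$; $\lambda$ binds index 1 of its body; $\mathsf{let}(M,N)$ binds index 1 in $N$; $\vartheta=\{M_1,\dots,M_9\}$ (resp. $\zeta=\{q_1,\dots,q_9\}$) is a family of nine terms (resp. trails) indexed by the trail constructors in the order $\mathsf{r},\mathsf{t},\mathsf{ba},\mathsf{bb},\mathsf{ti},\mathsf{lam},\mathsf{app},\mathsf{let},\mathsf{tr}$. $\mathrm{er}$ is explicit trail erasure, $\mathrm{tl}$ explicit trail extraction, $M[s]$ explicit substitution. ${\uparrow}^n={\uparrow}\circ\cdots\circ{\uparrow}$ ($n$ times); $1[{\uparrow}^n]$ is index $n+1$; $M[N]$ abbreviates $M[N\cdot\langle\rangle]$.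 $\sigma$-rules: $1[\langle\rangle]\to 1$; $1[M\cdot s]\to M$; $(\lambda.M)[s]\to \lambda.(M[1\cdot(s\circ{\uparrow})])$; $(M\,N)[s]\to M[s]\,N[s]$; $(!_qM)[s]\to !_q(M[s])$; $\mathsf{let}(M,N)[s]\to\mathsf{let}(M[s],N[1\cdot(s\circ{\uparrow})])$; $(q\triangleright M)[s]\to q\triangleright(M[s])$; $\iota(\{M_i\})[s]\to\iota(\{M_i[s]\})$; $M[s][t]\to M[s\circ t]$; $\langle\rangle\circ s\to s$; ${\uparrow}\circ\langle\rangle\to{\uparrow}$; ${\uparrow}\circ(M\cdot s)\to s$; $(M\cdot s)\circ t\to M[t]\cdot(s\circ t)$; $(s_1\circ s_2)\circ s_3\to s_1\circ(s_2\circ s_3)$; $\mathrm{er}(1)\to 1$; $\mathrm{er}(1[{\uparrow}^n])\to 1[{\uparrow}^n]$; $\mathrm{er}(\lambda.M)\to\lambda.\mathrm{er}(M)$; $\mathrm{er}(M\,N)\to\mathrm{er}(M)\,\mathrm{er}(N)$; $\mathrm{er}(!_qM)\to !_qM$; $\mathrm{er}(\mathsf{let}(M,N))\to\mathsf{let}(\mathrm{er}(M),\mathrm{er}(N))$; $\mathrm{er}(q\triangleright M)\to\mathrm{er}(M)$; $\mathrm{er}(\iota(\{M_i\}))\to\iota(\{\mathrm{er}(M_i)\})$; $\mathrm{tl}(1)\to\mathsf{r}$; $\mathrm{tl}(1[{\uparrow}^n])\to\mathsf{r}$; $\mathrm{tl}(\lambda.M)\to\mathsf{lam}(\mathrm{tl}(M))$;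 $\mathrm{tl}(M\,N)\to\mathsf{app}(\mathrm{tl}(M),\mathrm{tl}(N))$; $\mathrm{tl}(!_qM)\to\mathsf{r}$; $\mathrm{tl}(\mathsf{let}(M,N))\to\mathsf{let}(\mathrm{tl}(M),\mathrm{tl}(N))$; $\mathrm{tl}(q\triangleright M)\to\mathsf{t}(q,\mathrm{tl}(M))$; $\mathrm{tl}(\iota(\{M_i\}))\to\mathsf{tr}(\{\mathrm{tl}(M_i)\})$. $\tau$-rules: $\mathsf{r}\triangleright M\to M$; $q\triangleright(q'\triangleright M)\to\mathsf{t}(q,q')\triangleright M$; $!_q(q'\triangleright M)\to !_{\mathsf{t}(q,q')}M$; $\lambda.(q\triangleright M)\to\mathsf{lam}(q)\triangleright\lambda.M$; $(q\triangleright M)\,N\to\mathsf{app}(q,\mathsf{r})\triangleright M\,N$; $M\,(q\triangleright N)\to\mathsf{app}(\mathsf{r},q)\triangleright M\,N$; $\mathsf{let}(q\triangleright M,N)\to\mathsf{let}(q,\mathsf{r})\triangleright\mathsf{let}(M,N)$; $\mathsf{let}(M,q\triangleright N)\to\mathsf{let}(\mathsf{r},q)\triangleright\mathsf{let}(M,N)$; $\iota(\{M_1,\dots,q\triangleright M_i,\dots,M_9\})\to\mathsf{tr}(\{\mathsf{r},\dots,q,\dots,\mathsf{r}\})\triangleright\iota(\{M_1,\dots,M_9\})$; $\mathsf{t}(q,\mathsf{r})\to q$; $\mathsf{t}(\mathsf{r},q)\to q$; $\mathsf{tr}(\{\mathsf{r},\dots,\mathsf{r}\})\to\mathsf{r}$;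 $\mathsf{app}(\mathsf{r},\mathsf{r})\to\mathsf{r}$; $\mathsf{lam}(\mathsf{r})\to\mathsf{r}$; $\mathsf{let}(\mathsf{r},\mathsf{r})\to\mathsf{r}$; $\mathsf{t}(\mathsf{t}(q_1,q_2),q_3)\to\mathsf{t}(q_1,\mathsf{t}(q_2,q_3))$; $\mathsf{t}(\mathsf{lam}(q),\mathsf{lam}(q'))\to\mathsf{lam}(\mathsf{t}(q,q'))$; $\mathsf{t}(\mathsf{lam}(q_1),\mathsf{t}(\mathsf{lam}(q_1'),q))\to\mathsf{t}(\mathsf{lam}(\mathsf{t}(q_1,q_1')),q)$; $\mathsf{t}(\mathsf{app}(q_1,q_2),\mathsf{app}(q_1',q_2'))\to\mathsf{app}(\mathsf{t}(q_1,q_1'),\mathsf{t}(q_2,q_2'))$; $\mathsf{t}(\mathsf{app}(q_1,q_2),\mathsf{t}(\mathsf{app}(q_1',q_2'),q))\to\mathsf{t}(\mathsf{app}(\mathsf{t}(q_1,q_1'),\mathsf{t}(q_2,q_2')),q)$; the same two with $\mathsf{let}$ for $\mathsf{app}$; $\mathsf{t}(\mathsf{tr}(\{q_i\}),\mathsf{tr}(\{q_i'\}))\to\mathsf{tr}(\{\mathsf{t}(q_i,q_i')\})$; $\mathsf{t}(\mathsf{tr}(\{q_i\}),\mathsf{t}(\mathsf{tr}(\{q_i'\}),q))\to\mathsf{t}(\mathsf{tr}(\{\mathsf{t}(q_i,q_i')\}),q)$. $\sigma$- and $\tau$-rules apply anywhere; $\sigma\cup\tau$ is terminating and confluent and $\sigma\tau(X)$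 denotes the normal form of $X$; $\equiv_{\sigma\tau}$ is the equivalence closure of $\sigma\cup\tau$. Inspection of a trail: for a trail $q$ without $\mathrm{tl}$ and $\vartheta$, $q\vartheta$ is defined by $\mathsf{r}\vartheta=\vartheta(\mathsf{r})$, $\mathsf{ba}\vartheta=\vartheta(\mathsf{ba})$, $\mathsf{bb}\vartheta=\vartheta(\mathsf{bb})$, $\mathsf{ti}\vartheta=\vartheta(\mathsf{ti})$, $\mathsf{lam}(q)\vartheta=\vartheta(\mathsf{lam})\,(q\vartheta)$, $c(q,q')\vartheta=\vartheta(c)\,(q\vartheta)\,(q'\vartheta)$ for $c\in\{\mathsf{t},\mathsf{app},\mathsf{let}\}$, $\mathsf{tr}(\{q_1,\dots,q_9\})\vartheta=\vartheta(\mathsf{tr})\,(q_1\vartheta)\cdots(q_9\vartheta)$. Beta-reduction of $\mathrm{CAU}^-_\sigma$: with $F ::= \blacksquare \mid \lambda.F \mid F\,N \mid M\,F \mid \mathsf{let}(F,N) \mid \mathsf{let}(M,F) \mid q\triangleright F \mid \iota(\{\vec M,F,\vec N\}) \mid F[s]$: $(\lambda.M)\,N\to_{\mathrm{Beta}}\mathsf{t}(\mathsf{app}(\mathsf{lam}(\mathrm{tl}(M)),\mathrm{tl}(N)),\mathsf{ba})\triangleright\mathrm{er}(M)[\mathrm{er}(N)]$; $\mathsf{let}(!_qM,N)\to_{\mathrm{Beta}}\mathsf{t}(\mathsf{let}(\mathsf{r},\mathrm{tl}(N)),\mathsf{bb})\triangleright\mathrm{er}(N)[q\triangleright M]$; $!_qF[\iota(\vartheta)]\to_{\mathrm{Beta}}!_qF[\mathsf{ti}\triangleright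 q'\vartheta]$ where $q'=\sigma\tau(\mathsf{t}(q,\mathrm{tl}(F[\iota(\vartheta)])))$; closed under contexts $E_\sigma ::= \blacksquare \mid \lambda.E_\sigma \mid E_\sigma\,N \mid M\,E_\sigma \mid \mathsf{let}(E_\sigma,N) \mid \mathsf{let}(M,E_\sigma) \mid !_qE_\sigma \mid q\triangleright E_\sigma \mid \iota(\{\vec M,E_\sigma,\vec N\}) \mid E_\sigma[s] \mid M[S_\sigma]$, $S_\sigma ::= S_\sigma\circ t \mid s\circ S_\sigma \mid E_\sigma\cdot s \mid M\cdot S_\sigma$ (holes never inside $\mathrm{er}$). $\to_{\mathrm{CAU}^-_\sigma}\;=\;\to_{\mathrm{Beta}}\cup\equiv_{\sigma\tau}$. The calculus $\mathrm{CAU}^-$ (nameless): its terms are $M ::= 1 \mid 1[{\uparrow}^n] \mid \lambda.M \mid M\,N \mid \mathsf{let}(M,N) \mid !_qM \mid q\triangleright M \mid \iota(\vartheta)$ with trails not containing $\mathrm{tl}$ (these are particular $\mathrm{CAU}^-_\sigma$ terms). Contexts $E ::= \blacksquare \mid \lambda.E \mid E\,M \mid M\,E \mid \mathsf{let}(E,M) \mid \mathsf{let}(M,E) \mid !_qE \mid q\triangleright E \mid \iota(\{\vec M,E,\vec N\})$; bang-free contexts $F$ are the same without $!_qE$. Principal contractions: $(\lambda.M)\,N\to_\beta\mathsf{ba}\triangleright M\{N\}$; $\mathsf{let}(!_qM,N)\to_\beta\mathsf{bb}\triangleright N\{q\triangleright M\}$; $!_qF[\iota(\vartheta)]\to_\beta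 !_qF[\mathsf{ti}\triangleright q\vartheta]$; closed under $E$. Here $M\{N\}$ is standard capture-avoiding de Bruijn substitution of $N$ for index 1 in $M$ (decrementing the other free indices of $M$ and shifting free indices of $N$ under binders). $M\to_{\mathrm{CAU}^-}\tau(N)$ whenever $M\to_\beta N$, where $\tau(N)$ is the $\tau$-normal form.
   Formalization: The formal theorem additionally assumes that the initial term M is τ-normal; without this the claim fails, e.g. for M = (λ.(ti▷1)) 1, which reduces to t(ba,ti)▷1 in CAU⁻ but only to t(app(lam(ti),r),ba)▷1 in CAU⁻_σ. *)

(* Defs.v *)
From Stdlib Require Import List Arith Relations.
Import ListNotations.

Inductive tcon : Set :=
  | Kr | Kt | Kba | Kbb | Kti | Klam | Kapp | Klet | Ktr.

Definition tcons : list tcon :=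
  [Kr; Kt; Kba; Kbb; Kti; Klam; Kapp; Klet; Ktr].

Definition tcon_eq_dec (i j : tcon) : {i = j} + {i <> j}.
Proof. decide equality. Defined.

(* The replacement of the component of index i of a family by a. *)
Definition upd {A : Type} (f : tcon -> A) (i : tcon) (a : A) : tcon -> A :=
  fun j => if tcon_eq_dec j i then a else f j.

(* Families of nine terms (in [Iota]) or nine trails (in [Qtr]) are functions
   on [tcon]; they are meant up to functional extensionality. *)
Inductive term : Type :=
  | One                                  (* de Bruijn index 1 *)
  | Lam (M : term)
  | App (M N : term)
  | Let (M N : term)                     (* binds index 1 in N *)
  | Bang (q : trail) (M : term)          (* !_q M *)
  | Trail (q : trail) (M : term)         (* q |> M *)
  | Iota (th : tcon -> term)
  | Sub (M : term) (s : subst)           (* M[s] *)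
  | Er (M : term)
with trail : Type :=
  | Qr
  | Qt (q q' : trail)
  | Qba
  | Qbb
  | Qti
  | Qlam (q : trail)
  | Qapp (q q' : trail)
  | Qlet (q q' : trail)
  | Qtr (z : tcon -> trail)
  | Qtl (M : term)
with subst : Type :=
  | Sid                                  (* <>, the identity substitution *)
  | Sup
  | Scons (M : term) (s : subst)
  | Scomp (s t : subst).

(* [ups n] is Up^(n+1), with compositions nested to the right as in
   sigma-normal forms. *)
Fixpoint ups (n : nat) : subst :=
  match n with
  | 0 => Sup
  | S n => Scomp Sup (ups n)
  end.

(* [ix n] is the de Bruijn index n+1. *)
Definition ix (n : nat) : term :=
  match n with
  | 0 => One
  | S n => Sub One (ups n)
  end.

Inductive sigma_term : term -> term -> Prop :=
  | s_one_id : sigma_term (Sub One Sid) One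
  | s_one_cons M s : sigma_term (Sub One (Scons M s)) M
  | s_lam M s :
      sigma_term (Sub (Lam M) s) (Lam (Sub M (Scons One (Scomp s Sup))))
  | s_app M N s : sigma_term (Sub (App M N) s) (App (Sub M s) (Sub N s))
  | s_bang q M s : sigma_term (Sub (Bang q M) s) (Bang q (Sub M s))
  | s_let M N s :
      sigma_term (Sub (Let M N) s)
                 (Let (Sub M s) (Sub N (Scons One (Scomp s Sup))))
  | s_trail q M s : sigma_term (Sub (Trail q M) s) (Trail q (Sub M s))
  | s_iota th s : sigma_term (Sub (Iota th) s) (Iota (fun i => Sub (th i) s))
  | s_sub M s t : sigma_term (Sub (Sub M s) t) (Sub M (Scomp s t))
  | s_er_one : sigma_term (Er One) One
  | s_er_ups n : sigma_term (Er (Sub One (ups n))) (Sub One (ups n))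
  | s_er_lam M : sigma_term (Er (Lam M)) (Lam (Er M))
  | s_er_app M N : sigma_term (Er (App M N)) (App (Er M) (Er N))
  | s_er_bang q M : sigma_term (Er (Bang q M)) (Bang q M)
  | s_er_let M N : sigma_term (Er (Let M N)) (Let (Er M) (Er N))
  | s_er_trail q M : sigma_term (Er (Trail q M)) (Er M)
  | s_er_iota th : sigma_term (Er (Iota th)) (Iota (fun i => Er (th i))).

Inductive sigma_trail : trail -> trail -> Prop :=
  | s_tl_one : sigma_trail (Qtl One) Qr
  | s_tl_ups n : sigma_trail (Qtl (Sub One (ups n))) Qr
  | s_tl_lam M : sigma_trail (Qtl (Lam M)) (Qlam (Qtl M))
  | s_tl_app M N : sigma_trail (Qtl (App M N)) (Qapp (Qtl M) (Qtl N))
  | s_tl_bang q M : sigma_trail (Qtl (Bang q M)) Qr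
  | s_tl_let M N : sigma_trail (Qtl (Let M N)) (Qlet (Qtl M) (Qtl N))
  | s_tl_trail q M : sigma_trail (Qtl (Trail q M)) (Qt q (Qtl M))
  | s_tl_iota th : sigma_trail (Qtl (Iota th)) (Qtr (fun i => Qtl (th i))).

Inductive sigma_subst : subst -> subst -> Prop :=
  | s_id_comp s : sigma_subst (Scomp Sid s) s
  | s_up_id : sigma_subst (Scomp Sup Sid) Sup
  | s_up_cons M s : sigma_subst (Scomp Sup (Scons M s)) s
  | s_cons_comp M s t :
      sigma_subst (Scomp (Scons M s) t) (Scons (Sub M t) (Scomp s t))
  | s_assoc s1 s2 s3 :
      sigma_subst (Scomp (Scomp s1 s2) s3) (Scomp s1 (Scomp s2 s3)).

Inductive tau_term : term -> term -> Prop :=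
  | t_refl M : tau_term (Trail Qr M) M
  | t_trail q q' M : tau_term (Trail q (Trail q' M)) (Trail (Qt q q') M)
  | t_bang q q' M : tau_term (Bang q (Trail q' M)) (Bang (Qt q q') M)
  | t_lam q M : tau_term (Lam (Trail q M)) (Trail (Qlam q) (Lam M))
  | t_appl q M N : tau_term (App (Trail q M) N) (Trail (Qapp q Qr) (App M N))
  | t_appr q M N : tau_term (App M (Trail q N)) (Trail (Qapp Qr q) (App M N))
  | t_letl q M N : tau_term (Let (Trail q M) N) (Trail (Qlet q Qr) (Let M N))
  | t_letr q M N : tau_term (Let M (Trail q N)) (Trail (Qlet Qr q) (Let M N))
  | t_iota q th i :
      tau_term (Iota (upd th i (Trail q (th i))))
               (Trail (Qtr (upd (fun _ => Qr) i q)) (Iota th)).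

Inductive tau_trail : trail -> trail -> Prop :=
  | t_t_r q : tau_trail (Qt q Qr) q
  | t_r_t q : tau_trail (Qt Qr q) q
  | t_tr_r : tau_trail (Qtr (fun _ => Qr)) Qr
  | t_app_r : tau_trail (Qapp Qr Qr) Qr
  | t_lam_r : tau_trail (Qlam Qr) Qr
  | t_let_r : tau_trail (Qlet Qr Qr) Qr
  | t_assoc q1 q2 q3 : tau_trail (Qt (Qt q1 q2) q3) (Qt q1 (Qt q2 q3))
  | t_lam_lam q q' : tau_trail (Qt (Qlam q) (Qlam q')) (Qlam (Qt q q'))
  | t_lam_lam_t q1 q1' q :
      tau_trail (Qt (Qlam q1) (Qt (Qlam q1') q)) (Qt (Qlam (Qt q1 q1')) q)
  | t_app_app q1 q2 q1' q2' :
      tau_trail (Qt (Qapp q1 q2) (Qapp q1' q2')) (Qapp (Qt q1 q1') (Qt q2 q2'))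
  | t_app_app_t q1 q2 q1' q2' q :
      tau_trail (Qt (Qapp q1 q2) (Qt (Qapp q1' q2') q))
                (Qt (Qapp (Qt q1 q1') (Qt q2 q2')) q)
  | t_let_let q1 q2 q1' q2' :
      tau_trail (Qt (Qlet q1 q2) (Qlet q1' q2')) (Qlet (Qt q1 q1') (Qt q2 q2'))
  | t_let_let_t q1 q2 q1' q2' q :
      tau_trail (Qt (Qlet q1 q2) (Qt (Qlet q1' q2') q))
                (Qt (Qlet (Qt q1 q1') (Qt q2 q2')) q)
  | t_tr_tr z z' :
      tau_trail (Qt (Qtr z) (Qtr z')) (Qtr (fun i => Qt (z i) (z' i)))
  | t_tr_tr_t z z' q :
      tau_trail (Qt (Qtr z) (Qt (Qtr z') q))
                (Qt (Qtr (fun i => Qt (z i) (z' i))) q).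

(* Compatible closure: one step of a triple of base relations at an arbitrary
   position of a term, a trail or a substitution. *)
Inductive cl_term (RM : relation term) (RQ : relation trail)
    (RS : relation subst) : term -> term -> Prop :=
  | c_base M M' : RM M M' -> cl_term RM RQ RS M M'
  | c_lam M M' : cl_term RM RQ RS M M' -> cl_term RM RQ RS (Lam M) (Lam M')
  | c_appl M M' N :
      cl_term RM RQ RS M M' -> cl_term RM RQ RS (App M N) (App M' N)
  | c_appr M N N' :
      cl_term RM RQ RS N N' -> cl_term RM RQ RS (App M N) (App M N')
  | c_letl M M' N :
      cl_term RM RQ RS M M' -> cl_term RM RQ RS (Let M N) (Let M' N)
  | c_letr M N N' :
      cl_term RM RQ RS N N' -> cl_term RM RQ RS (Let M N) (Let M N')
  | c_bangq q q' M :
      cl_trail RM RQ RS q q' -> cl_term RM RQ RS (Bang q M) (Bang q' M)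
  | c_bang q M M' :
      cl_term RM RQ RS M M' -> cl_term RM RQ RS (Bang q M) (Bang q M')
  | c_trailq q q' M :
      cl_trail RM RQ RS q q' -> cl_term RM RQ RS (Trail q M) (Trail q' M)
  | c_trail q M M' :
      cl_term RM RQ RS M M' -> cl_term RM RQ RS (Trail q M) (Trail q M')
  | c_iota th i M' :
      cl_term RM RQ RS (th i) M' ->
      cl_term RM RQ RS (Iota th) (Iota (upd th i M'))
  | c_subl M M' s :
      cl_term RM RQ RS M M' -> cl_term RM RQ RS (Sub M s) (Sub M' s)
  | c_subr M s s' :
      cl_subst RM RQ RS s s' -> cl_term RM RQ RS (Sub M s) (Sub M s')
  | c_er M M' : cl_term RM RQ RS M M' -> cl_term RM RQ RS (Er M) (Er M')
with cl_trail (RM : relation term) (RQ : relation trail)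
    (RS : relation subst) : trail -> trail -> Prop :=
  | cq_base q q' : RQ q q' -> cl_trail RM RQ RS q q'
  | cq_tl q1 q1' q2 :
      cl_trail RM RQ RS q1 q1' -> cl_trail RM RQ RS (Qt q1 q2) (Qt q1' q2)
  | cq_tr q1 q2 q2' :
      cl_trail RM RQ RS q2 q2' -> cl_trail RM RQ RS (Qt q1 q2) (Qt q1 q2')
  | cq_lam q q' :
      cl_trail RM RQ RS q q' -> cl_trail RM RQ RS (Qlam q) (Qlam q')
  | cq_appl q1 q1' q2 :
      cl_trail RM RQ RS q1 q1' -> cl_trail RM RQ RS (Qapp q1 q2) (Qapp q1' q2)
  | cq_appr q1 q2 q2' :
      cl_trail RM RQ RS q2 q2' -> cl_trail RM RQ RS (Qapp q1 q2) (Qapp q1 q2')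
  | cq_letl q1 q1' q2 :
      cl_trail RM RQ RS q1 q1' -> cl_trail RM RQ RS (Qlet q1 q2) (Qlet q1' q2)
  | cq_letr q1 q2 q2' :
      cl_trail RM RQ RS q2 q2' -> cl_trail RM RQ RS (Qlet q1 q2) (Qlet q1 q2')
  | cq_fam z i q' :
      cl_trail RM RQ RS (z i) q' ->
      cl_trail RM RQ RS (Qtr z) (Qtr (upd z i q'))
  | cq_ext M M' : cl_term RM RQ RS M M' -> cl_trail RM RQ RS (Qtl M) (Qtl M')
with cl_subst (RM : relation term) (RQ : relation trail)
    (RS : relation subst) : subst -> subst -> Prop :=
  | cs_base s s' : RS s s' -> cl_subst RM RQ RS s s'
  | cs_consl M M' s :
      cl_term RM RQ RS M M' -> cl_subst RM RQ RS (Scons M s) (Scons M' s)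
  | cs_consr M s s' :
      cl_subst RM RQ RS s s' -> cl_subst RM RQ RS (Scons M s) (Scons M s')
  | cs_compl s s' t :
      cl_subst RM RQ RS s s' -> cl_subst RM RQ RS (Scomp s t) (Scomp s' t)
  | cs_compr s t t' :
      cl_subst RM RQ RS t t' -> cl_subst RM RQ RS (Scomp s t) (Scomp s t').

Definition tau : relation term :=
  cl_term tau_term tau_trail (fun _ _ => False).

Definition sigmatau : relation term :=
  cl_term (union _ sigma_term tau_term) (union _ sigma_trail tau_trail)
    sigma_subst.
Definition sigmatau_q : relation trail :=
  cl_trail (union _ sigma_term tau_term) (union _ sigma_trail tau_trail)
    sigma_subst.

Definition equiv_sigmatau : relation term := clos_refl_sym_trans term sigmatau.

Definition normal {A : Type} (R : relation A) (x : A) : Prop :=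
  forall y, ~ R x y.

(* y is the R-normal form of x; for tau and sigmatau, which are terminating
   and confluent, this is the graph of a function. *)
Definition nf_of {A : Type} (R : relation A) (x y : A) : Prop :=
  clos_refl_trans A R x y /\ normal R y.

Inductive tl_free : trail -> Prop :=
  | tf_r : tl_free Qr
  | tf_t q q' : tl_free q -> tl_free q' -> tl_free (Qt q q')
  | tf_ba : tl_free Qba
  | tf_bb : tl_free Qbb
  | tf_ti : tl_free Qti
  | tf_lam q : tl_free q -> tl_free (Qlam q)
  | tf_app q q' : tl_free q -> tl_free q' -> tl_free (Qapp q q')
  | tf_let q q' : tl_free q -> tl_free q' -> tl_free (Qlet q q')
  | tf_tr z : (forall i, tl_free (z i)) -> tl_free (Qtr z).

(* Only meaningful on trails without [Qtl], where it is used; the value at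
   [Qtl] is irrelevant. *)
Fixpoint inspect (q : trail) (th : tcon -> term) : term :=
  match q with
  | Qr => th Kr
  | Qt q q' => App (App (th Kt) (inspect q th)) (inspect q' th)
  | Qba => th Kba
  | Qbb => th Kbb
  | Qti => th Kti
  | Qlam q => App (th Klam) (inspect q th)
  | Qapp q q' => App (App (th Kapp) (inspect q th)) (inspect q' th)
  | Qlet q q' => App (App (th Klet) (inspect q th)) (inspect q' th)
  | Qtr z => fold_left App (map (fun i => inspect (z i) th) tcons) (th Ktr)
  | Qtl _ => th Kr
  end.

Inductive fctx : Type :=
  | FHole
  | FLam (F : fctx)
  | FAppL (F : fctx) (N : term)
  | FAppR (M : term) (F : fctx)
  | FLetL (F : fctx) (N : term)
  | FLetR (M : term) (F : fctx)
  | FTrail (q : trail) (F : fctx)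
  | FIota (th : tcon -> term) (i : tcon) (F : fctx)
      (* th with its component of index i (which is irrelevant) replaced by F *)
  | FSub (F : fctx) (s : subst).

Fixpoint fill (F : fctx) (P : term) : term :=
  match F with
  | FHole => P
  | FLam F => Lam (fill F P)
  | FAppL F N => App (fill F P) N
  | FAppR M F => App M (fill F P)
  | FLetL F N => Let (fill F P) N
  | FLetR M F => Let M (fill F P)
  | FTrail q F => Trail q (fill F P)
  | FIota th i F => Iota (upd th i (fill F P))
  | FSub F s => Sub (fill F P) s
  end.

(* The bang-free contexts of the calculus without explicit substitutions. *)
Inductive cau_fctx : fctx -> Prop :=
  | cf_hole : cau_fctx FHole
  | cf_lam F : cau_fctx F -> cau_fctx (FLam F)
  | cf_appl F N : cau_fctx F -> cau_fctx (FAppL F N)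
  | cf_appr M F : cau_fctx F -> cau_fctx (FAppR M F)
  | cf_letl F N : cau_fctx F -> cau_fctx (FLetL F N)
  | cf_letr M F : cau_fctx F -> cau_fctx (FLetR M F)
  | cf_trail q F : cau_fctx F -> cau_fctx (FTrail q F)
  | cf_iota th i F : cau_fctx F -> cau_fctx (FIota th i F).

Definition sub1 (M N : term) : term := Sub M (Scons N Sid).

Inductive Beta_contr : term -> term -> Prop :=
  | Beta_lam M N :
      Beta_contr (App (Lam M) N)
        (Trail (Qt (Qapp (Qlam (Qtl M)) (Qtl N)) Qba) (sub1 (Er M) (Er N)))
  | Beta_let q M N :
      Beta_contr (Let (Bang q M) N)
        (Trail (Qt (Qlet Qr (Qtl N)) Qbb) (sub1 (Er N) (Trail q M)))
  | Beta_inspect q F th q' :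
      nf_of sigmatau_q (Qt q (Qtl (fill F (Iota th)))) q' ->
      tl_free q' ->
      Beta_contr (Bang q (fill F (Iota th)))
        (Bang q (fill F (Trail Qti (inspect q' th)))).

(* Closure under the contexts E (first relation) and S (second relation). *)
Inductive Beta : term -> term -> Prop :=
  | B_contr M M' : Beta_contr M M' -> Beta M M'
  | B_lam M M' : Beta M M' -> Beta (Lam M) (Lam M')
  | B_appl M M' N : Beta M M' -> Beta (App M N) (App M' N)
  | B_appr M N N' : Beta N N' -> Beta (App M N) (App M N')
  | B_letl M M' N : Beta M M' -> Beta (Let M N) (Let M' N)
  | B_letr M N N' : Beta N N' -> Beta (Let M N) (Let M N')
  | B_bang q M M' : Beta M M' -> Beta (Bang q M) (Bang q M')
  | B_trail q M M' : Beta M M' -> Beta (Trail q M) (Trail q M')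
  | B_iota th i M' : Beta (th i) M' -> Beta (Iota th) (Iota (upd th i M'))
  | B_subl M M' s : Beta M M' -> Beta (Sub M s) (Sub M' s)
  | B_subr M s s' : Beta_subst s s' -> Beta (Sub M s) (Sub M s')
with Beta_subst : subst -> subst -> Prop :=
  | BS_compl s s' t : Beta_subst s s' -> Beta_subst (Scomp s t) (Scomp s' t)
  | BS_compr s t t' : Beta_subst t t' -> Beta_subst (Scomp s t) (Scomp s t')
  | BS_consl M M' s : Beta M M' -> Beta_subst (Scons M s) (Scons M' s)
  | BS_consr M s s' : Beta_subst s s' -> Beta_subst (Scons M s) (Scons M s').

Definition caus_step : relation term := union term Beta equiv_sigmatau.

Inductive cau_term : term -> Prop :=
  | ct_ix n : cau_term (ix n)
  | ct_lam M : cau_term M -> cau_term (Lam M)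
  | ct_app M N : cau_term M -> cau_term N -> cau_term (App M N)
  | ct_let M N : cau_term M -> cau_term N -> cau_term (Let M N)
  | ct_bang q M : tl_free q -> cau_term M -> cau_term (Bang q M)
  | ct_trail q M : tl_free q -> cau_term M -> cau_term (Trail q M)
  | ct_iota th : (forall i, cau_term (th i)) -> cau_term (Iota th).

(* [index_of M = Some n] iff [M = ix n]. *)
Fixpoint ups_of (s : subst) : option nat :=
  match s with
  | Sup => Some 0
  | Scomp Sup s => option_map S (ups_of s)
  | _ => None
  end.

Definition index_of (M : term) : option nat :=
  match M with
  | One => Some 0
  | Sub One s => option_map S (ups_of s)
  | _ => None
  end.

(* [shift c M] adds 1 to the indices of M that are free beyond the first c.
   Like [msubst], it is only meaningful on [cau_term]s. *)
Fixpoint shift (c : nat) (M : term) : term :=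
  match index_of M with
  | Some n => ix (if n <? c then n else S n)
  | None =>
      match M with
      | Lam M => Lam (shift (S c) M)
      | App M N => App (shift c M) (shift c N)
      | Let M N => Let (shift c M) (shift (S c) N)
      | Bang q M => Bang q (shift c M)
      | Trail q M => Trail q (shift c M)
      | Iota th => Iota (fun i => shift c (th i))
      | _ => M
      end
  end.

(* Substitution of N for the index k+1 in M, where N already lives under the
   k enclosing binders. *)
Fixpoint msubst (k : nat) (N M : term) : term :=
  match index_of M with
  | Some n => if n <? k then ix n else if n =? k then N else ix (pred n)
  | None =>
      match M with
      | Lam M => Lam (msubst (S k) (shift 0 N) M)
      | App M1 M2 => App (msubst k N M1) (msubst k N M2)
      | Let M1 M2 => Let (msubst k N M1) (msubst (S k) (shift 0 N) M2)
      | Bang q M => Bang q (msubst k N M)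
      | Trail q M => Trail q (msubst k N M)
      | Iota th => Iota (fun i => msubst k N (th i))
      | _ => M
      end
  end.

(* M{N} *)
Definition msubst1 (M N : term) : term := msubst 0 N M.

Inductive beta_contr : term -> term -> Prop :=
  | beta_lam M N :
      beta_contr (App (Lam M) N) (Trail Qba (msubst1 M N))
  | beta_let q M N :
      beta_contr (Let (Bang q M) N) (Trail Qbb (msubst1 N (Trail q M)))
  | beta_inspect q F th :
      cau_fctx F -> tl_free q ->
      beta_contr (Bang q (fill F (Iota th)))
        (Bang q (fill F (Trail Qti (inspect q th)))).

Inductive beta : term -> term -> Prop :=
  | b_contr M M' : beta_contr M M' -> beta M M'
  | b_lam M M' : beta M M' -> beta (Lam M) (Lam M')
  | b_appl M M' N : beta M M' -> beta (App M N) (App M' N)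
  | b_appr M N N' : beta N N' -> beta (App M N) (App M N')
  | b_letl M M' N : beta M M' -> beta (Let M N) (Let M' N)
  | b_letr M N N' : beta N N' -> beta (Let M N) (Let M N')
  | b_bang q M M' : beta M M' -> beta (Bang q M) (Bang q M')
  | b_trail q M M' : beta M M' -> beta (Trail q M) (Trail q M')
  | b_iota th i M' : beta (th i) M' -> beta (Iota th) (Iota (upd th i M')).

(* This does not ask M itself to be tau-normal. Out of a term that is not, it
   disagrees with [caus_step]: [beta_inspect] ignores the trails held by F,
   whereas [Beta_inspect] collects them. *)
Definition cau_step : relation term :=
  fun M N => exists P, beta M P /\ nf_of tau P N.

(* Main.v *)
(** Out of the root, a trail of a tau-normal term without explicit substitutions
    would form a tau-redex with its parent, so every term [X] below a redex
    satisfies [er(X) = X] and [tl(X) = r] up to sigma and tau. Hence the trails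
    recorded by a Beta contraction collapse to those of the corresponding beta
    contraction, and the trail [q'] inspected by Beta is the annotation [q] of
    the bang. It remains to compare [M[N . <>]] with [M{N}], by descending under
    binders with the substitutions obtained from [N . <>] and [Up] by iterating
    [s |-> 1 . (s o Up)]. *)

Require Import Defs.
From Stdlib Require Import Relations List Arith Lia Morphisms Setoid FunctionalExtensionality.

(** * Families *)

Lemma upd_same {A : Type} (f : tcon -> A) i a : upd f i a i = a.
Proof. unfold upd. destruct (tcon_eq_dec i i); congruence. Qed.

Lemma upd_upd {A : Type} (f : tcon -> A) i a b : upd (upd f i a) i b = upd f i b.
Proof.
  apply functional_extensionality; intro j; unfold upd.
  destruct (tcon_eq_dec j i); reflexivity.
Qed.

Lemma upd_id {A : Type} (f : tcon -> A) i : upd f i (f i) = f.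
Proof.
  apply functional_extensionality; intro j; unfold upd.
  destruct (tcon_eq_dec j i); congruence.
Qed.

Lemma upd_pred {A : Type} (P : A -> Prop) f i a :
  (forall j, P (f j)) -> P a -> forall j, P (upd f i a j).
Proof. intros Hf Ha j; unfold upd; destruct (tcon_eq_dec j i); auto. Qed.

(** The hypothesis bears on the updated family because the component of index [i] of [f] itself may
    be arbitrary, as in [FIota] and [t_iota]. *)
Lemma upd_pred_replace {A : Type} (P : A -> Prop) f i a b :
  (forall j, P (upd f i a j)) -> P b -> forall j, P (upd f i b j).
Proof.
  intros Hf Hb. rewrite <- (upd_upd f i a b). apply upd_pred; assumption.
Qed.

(** * Congruences *)

Lemma clos_rt_map {A B : Type} (R : relation A) (R' : relation B) (f : A -> B) :
  (forall x y, R x y -> R' (f x) (f y)) ->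
  forall x y, clos_refl_trans A R x y -> clos_refl_trans B R' (f x) (f y).
Proof.
  intros Hf x y H; induction H; eauto using rt_step, rt_refl, rt_trans.
Qed.

Lemma clos_rst_map {A B : Type} (R : relation A) (R' : relation B) (f : A -> B) :
  (forall x y, R x y -> R' (f x) (f y)) ->
  forall x y, clos_refl_sym_trans A R x y -> clos_refl_sym_trans B R' (f x) (f y).
Proof.
  intros Hf x y H;
    induction H; eauto using rst_step, rst_refl, rst_sym, rst_trans.
Qed.

(** Families are finite, so [f] becomes [g] through nine one-component updates, chained by
    transitivity. *)
Lemma family_congruence {A B : Type} (S : relation A) (S' : relation B)
    (K : (tcon -> A) -> B) :
  reflexive B S' -> transitive B S' ->
  (forall f i x y, S x y -> S' (K (upd f i x)) (K (upd f i y))) ->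
  forall f g, (forall i, S (f i) (g i)) -> S' (K f) (K g).
Proof.
  intros Hr Ht HK f g Hfg.
  assert (step : forall h i, h i = f i -> S' (K h) (K (upd h i (g i)))).
  { intros h i e. rewrite <- (upd_id h i) at 1. rewrite e. auto. }
  (* [l] lists the components still to be replaced, where [h] agrees with [f]; without duplicates,
     an update leaves the later ones untouched. *)
  assert (H : forall l h, NoDup l -> (forall i, In i l -> h i = f i) ->
             S' (K h) (K (fold_left (fun h i => upd h i (g i)) l h))).
  { induction l as [|i l IH]; intros h Hl Hh; simpl; [apply Hr|].
    inversion Hl as [|? ? Hil Hl']; subst.
    eapply Ht; [apply step, Hh; now left|].
    apply IH; [assumption|]. intros j Hj. unfold upd.
    destruct (tcon_eq_dec j i) as [->|_]; [contradiction|].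
    apply Hh; now right. }
  replace g with (fold_left (fun h i => upd h i (g i)) tcons f).
  - apply H; [|reflexivity]. unfold tcons.
    repeat constructor; simpl; intuition discriminate.
  - apply functional_extensionality; intros []; reflexivity.
Qed.

(** Stated for reduction rather than equivalence: [Beta_inspect] asks for a reduction to the normal
    form. *)
Lemma sigmatau_q_Qtr z z' :
  (forall i, clos_refl_trans trail sigmatau_q (z i) (z' i)) ->
  clos_refl_trans trail sigmatau_q (Qtr z) (Qtr z').
Proof.
  apply (family_congruence (clos_refl_trans trail sigmatau_q)).
  - intro; apply rt_refl.
  - intros ? ? ?; apply rt_trans.
  - intros f i. apply (clos_rt_map _ _ (fun x => Qtr (upd f i x))).
    intros x y H. rewrite <- (upd_upd f i x y).
    apply cq_fam. now rewrite upd_same.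
Qed.

Definition equiv_q : relation trail := clos_refl_sym_trans trail sigmatau_q.
Definition equiv_s : relation subst :=
  clos_refl_sym_trans subst
    (cl_subst (union _ sigma_term tau_term) (union _ sigma_trail tau_trail)
       sigma_subst).

Lemma equiv_Iota th th' :
  (forall i, equiv_sigmatau (th i) (th' i)) ->
  equiv_sigmatau (Iota th) (Iota th').
Proof.
  apply (family_congruence equiv_sigmatau).
  - intro; apply rst_refl.
  - intros ? ? ?; apply rst_trans.
  - intros f i. apply (clos_rst_map _ _ (fun x => Iota (upd f i x))).
    intros x y H. rewrite <- (upd_upd f i x y).
    apply c_iota. now rewrite upd_same.
Qed.

#[local] Instance equiv_sigmatau_Equivalence : Equivalence equiv_sigmatau.
Proof.
  split; [intro; apply rst_refl | intros ? ?; apply rst_sym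
         | intros ? ? ?; apply rst_trans].
Qed.

#[local] Instance equiv_q_Equivalence : Equivalence equiv_q.
Proof.
  split; [intro; apply rst_refl | intros ? ?; apply rst_sym
         | intros ? ? ?; apply rst_trans].
Qed.

#[local] Instance equiv_s_Equivalence : Equivalence equiv_s.
Proof.
  split; [intro; apply rst_refl | intros ? ?; apply rst_sym
         | intros ? ? ?; apply rst_trans].
Qed.

Ltac congruence1 f :=
  let x := fresh "x" in let y := fresh "y" in let H := fresh "H" in
  intros x y H; eapply (clos_rst_map _ _ f); [|exact H];
  intros; constructor; assumption.

Ltac congruence2 f :=
  let x := fresh "x" in let x' := fresh "x'" in let Hx := fresh "Hx" in
  let y := fresh "y" in let y' := fresh "y'" in let Hy := fresh "Hy" in
  intros x x' Hx y y' Hy; transitivity (f x' y);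
  [ eapply (clos_rst_map _ _ (fun z => f z y)); [|exact Hx]
  | eapply (clos_rst_map _ _ (f x')); [|exact Hy] ];
  intros; constructor; assumption.

#[local] Instance Lam_equiv : Proper (equiv_sigmatau ==> equiv_sigmatau) Lam.
Proof. congruence1 Lam. Qed.

#[local] Instance App_equiv :
  Proper (equiv_sigmatau ==> equiv_sigmatau ==> equiv_sigmatau) App.
Proof. congruence2 App. Qed.

#[local] Instance Let_equiv :
  Proper (equiv_sigmatau ==> equiv_sigmatau ==> equiv_sigmatau) Let.
Proof. congruence2 Let. Qed.

#[local] Instance Bang_equiv :
  Proper (equiv_q ==> equiv_sigmatau ==> equiv_sigmatau) Bang.
Proof. congruence2 Bang. Qed.

#[local] Instance Trail_equiv :
  Proper (equiv_q ==> equiv_sigmatau ==> equiv_sigmatau) Trail.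
Proof. congruence2 Trail. Qed.

#[local] Instance Sub_equiv :
  Proper (equiv_sigmatau ==> equiv_s ==> equiv_sigmatau) Sub.
Proof. congruence2 Sub. Qed.

#[local] Instance Scons_equiv :
  Proper (equiv_sigmatau ==> equiv_s ==> equiv_s) Scons.
Proof. congruence2 Scons. Qed.

#[local] Instance Scomp_equiv : Proper (equiv_s ==> equiv_s ==> equiv_s) Scomp.
Proof. congruence2 Scomp. Qed.

#[local] Instance Qt_equiv : Proper (equiv_q ==> equiv_q ==> equiv_q) Qt.
Proof. congruence2 Qt. Qed.

#[local] Instance Qlam_equiv : Proper (equiv_q ==> equiv_q) Qlam.
Proof. congruence1 Qlam. Qed.

#[local] Instance Qapp_equiv : Proper (equiv_q ==> equiv_q ==> equiv_q) Qapp.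
Proof. congruence2 Qapp. Qed.

#[local] Instance Qlet_equiv : Proper (equiv_q ==> equiv_q ==> equiv_q) Qlet.
Proof. congruence2 Qlet. Qed.

Lemma sigma_equiv M N : sigma_term M N -> equiv_sigmatau M N.
Proof. intro; apply rst_step, c_base; now left. Qed.

Lemma sigma_subst_equiv s t : sigma_subst s t -> equiv_s s t.
Proof. intro; now apply rst_step, cs_base. Qed.

Lemma sigma_trail_rt q q' :
  sigma_trail q q' -> clos_refl_trans trail sigmatau_q q q'.
Proof. intro; apply rt_step, cq_base; now left. Qed.

Lemma tau_trail_rt q q' :
  tau_trail q q' -> clos_refl_trans trail sigmatau_q q q'.
Proof. intro; apply rt_step, cq_base; now right. Qed.

Lemma tau_trail_equiv q q' : tau_trail q q' -> equiv_q q q'.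
Proof. intro; apply rst_step, cq_base; now right. Qed.

Lemma clos_rt_monotone {A : Type} (R R' : relation A) :
  (forall x y, R x y -> R' x y) ->
  forall x y, clos_refl_trans A R x y -> clos_refl_trans A R' x y.
Proof. exact (fun H => clos_rt_map R R' (fun x => x) H). Qed.

Scheme cl_term_mut := Minimality for cl_term Sort Prop
  with cl_trail_mut := Minimality for cl_trail Sort Prop
  with cl_subst_mut := Minimality for cl_subst Sort Prop.

Lemma tau_sigmatau M N : tau M N -> sigmatau M N.
Proof.
  unfold tau, sigmatau.
  set (RM := union _ sigma_term tau_term).
  set (RQ := union _ sigma_trail tau_trail).
  apply (cl_term_mut tau_term tau_trail (fun _ _ => False)
           (cl_term RM RQ sigma_subst) (cl_trail RM RQ sigma_subst)
           (cl_subst RM RQ sigma_subst));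
    try (intros; constructor; assumption).
  - intros; apply c_base; now right.
  - intros; apply cq_base; now right.
  - contradiction.
Qed.

(** * Substitution *)

(** [ups] adds its [Sup] on the left, whereas shifting an index composes one on the right;
    associativity moves it across. *)
Lemma ups_S_comp n : equiv_s (ups (S n)) (Scomp (ups n) Sup).
Proof.
  induction n as [|n IH]; [reflexivity|].
  transitivity (Scomp Sup (Scomp (ups n) Sup)).
  - apply Scomp_equiv; [reflexivity|exact IH].
  - symmetry. apply sigma_subst_equiv, s_assoc.
Qed.

Lemma Sub_Scomp M s t : equiv_sigmatau (Sub M (Scomp s t)) (Sub (Sub M s) t).
Proof. symmetry. apply sigma_equiv, s_sub. Qed.

Lemma ix_Sid n : equiv_sigmatau (Sub (ix n) Sid) (ix n).
Proof.
  destruct n as [|n]; simpl; [apply sigma_equiv, s_one_id|].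
  rewrite <- Sub_Scomp. apply Sub_equiv; [reflexivity|].
  induction n as [|n IH]; simpl; [apply sigma_subst_equiv, s_up_id|].
  rewrite (sigma_subst_equiv _ _ (s_assoc _ _ _)). now rewrite IH.
Qed.

Lemma ix_Sup n : equiv_sigmatau (Sub (ix n) Sup) (ix (S n)).
Proof.
  destruct n as [|n]; [reflexivity|]. simpl ix at 1.
  rewrite <- Sub_Scomp, <- ups_S_comp. reflexivity.
Qed.

(** Reading [ix (S n)] as a shift of [ix n] puts a [Sup] in front of the cons, which then loses its
    head. *)
Lemma ix_S_Scons n M s :
  equiv_sigmatau (Sub (ix (S n)) (Scons M s)) (Sub (ix n) s).
Proof.
  rewrite <- ix_Sup, <- Sub_Scomp.
  now rewrite (sigma_subst_equiv _ _ (s_up_cons _ _)).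
Qed.

(** * Lifted substitutions against [shift] and [msubst] *)

Fixpoint liftn (k : nat) (s : subst) : subst :=
  match k with
  | 0 => s
  | S k => Scons One (Scomp (liftn k s) Sup)
  end.

Lemma ups_of_ups n : ups_of (ups n) = Some n.
Proof. induction n as [|n IH]; simpl; [|rewrite IH]; reflexivity. Qed.

Lemma index_of_ix n : index_of (ix n) = Some n.
Proof. destruct n; simpl; [|rewrite ups_of_ups]; reflexivity. Qed.

Lemma shift_ix c n : shift c (ix n) = ix (if n <? c then n else S n).
Proof.
  pose proof (index_of_ix n) as e.
  destruct n; simpl in *; [|rewrite e]; reflexivity.
Qed.

Lemma msubst_ix k N n :
  msubst k N (ix n) =
  if n <? k then ix n else if n =? k then N else ix (pred n).
Proof.
  pose proof (index_of_ix n) as e.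
  destruct n; simpl in *; [|rewrite e]; reflexivity.
Qed.

Lemma cau_shift M c : cau_term M -> cau_term (shift c M).
Proof.
  intro H; revert c; induction H; intro c; simpl; try (constructor; auto; fail).
  rewrite shift_ix. constructor.
Qed.

Lemma cau_msubst M N k : cau_term M -> cau_term N -> cau_term (msubst k N M).
Proof.
  intro H; revert k N; induction H; intros k P HP; simpl;
    try (constructor; auto using cau_shift; fail).
  rewrite msubst_ix. destruct (n <? k), (n =? k); try constructor; assumption.
Qed.

(** Index 1 meets the head [One]; any other index drops under one binder less and is raised again by
    the trailing [Sup]. *)
Lemma ix_liftn_Sup c n :
  equiv_sigmatau (Sub (ix n) (liftn c Sup)) (shift c (ix n)).
Proof.
  rewrite shift_ix. revert n; induction c as [|c IH]; intro n; simpl liftn.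
  - apply ix_Sup.
  - destruct n as [|n]; [apply sigma_equiv, s_one_cons|].
    rewrite ix_S_Scons, Sub_Scomp, IH, ix_Sup.
    change (S n <? S c) with (n <? c). destruct (n <? c); reflexivity.
Qed.

Lemma Sub_liftn_Sup M c :
  cau_term M -> equiv_sigmatau (Sub M (liftn c Sup)) (shift c M).
Proof.
  intro H; revert c; induction H; intro c; try apply ix_liftn_Sup; simpl.
  - rewrite (sigma_equiv _ _ (s_lam _ _)). now rewrite (IHcau_term (S c)).
  - rewrite (sigma_equiv _ _ (s_app _ _ _)). now rewrite IHcau_term1, IHcau_term2.
  - rewrite (sigma_equiv _ _ (s_let _ _ _)).
    now rewrite IHcau_term1, (IHcau_term2 (S c)).
  - rewrite (sigma_equiv _ _ (s_bang _ _ _)). now rewrite IHcau_term.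
  - rewrite (sigma_equiv _ _ (s_trail _ _ _)). now rewrite IHcau_term.
  - rewrite (sigma_equiv _ _ (s_iota _ _)). apply equiv_Iota; auto.
Qed.

Lemma cau_iter_shift N k : cau_term N -> cau_term (Nat.iter k (shift 0) N).
Proof. intro; induction k; simpl; auto using cau_shift. Qed.

(** [msubst k] expects a term already living under [k] binders, hence the [k]-fold shift of [N]. *)
Lemma ix_liftn_Scons N k n : cau_term N ->
  equiv_sigmatau (Sub (ix n) (liftn k (Scons N Sid)))
    (msubst k (Nat.iter k (shift 0) N) (ix n)).
Proof.
  intro HN. rewrite msubst_ix.
  revert n; induction k as [|k IH]; intro n; simpl liftn.
  - destruct n as [|n]; [apply sigma_equiv, s_one_cons|].
    rewrite ix_S_Scons. apply ix_Sid.
  - destruct n as [|n]; [apply sigma_equiv, s_one_cons|].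
    rewrite ix_S_Scons, Sub_Scomp, IH.
    change (S n <? S k) with (n <? k). change (S n =? S k) with (n =? k).
    destruct (Nat.ltb_spec n k); [apply ix_Sup|].
    destruct (Nat.eqb_spec n k).
    (* The trailing [Sup] is [liftn 0 Sup]; it supplies the last of the [S k] shifts of [N]. *)
    + apply (Sub_liftn_Sup _ 0), cau_iter_shift, HN.
    (* Here [k < n], so [n] is a successor and the truncated [pred] is harmless. *)
    + rewrite ix_Sup. destruct n; [lia|reflexivity].
Qed.

Lemma Sub_liftn_Scons M N k : cau_term M -> cau_term N ->
  equiv_sigmatau (Sub M (liftn k (Scons N Sid)))
    (msubst k (Nat.iter k (shift 0) N) M).
Proof.
  intros H HN; revert k; induction H; intro k;
    try (now apply ix_liftn_Scons); simpl.
  (* The [S k]-fold iterate unfolds to the [shift 0] that [msubst] performs when crossing the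
     binder. *)
  - rewrite (sigma_equiv _ _ (s_lam _ _)). now rewrite (IHcau_term (S k)).
  - rewrite (sigma_equiv _ _ (s_app _ _ _)). now rewrite IHcau_term1, IHcau_term2.
  - rewrite (sigma_equiv _ _ (s_let _ _ _)).
    now rewrite IHcau_term1, (IHcau_term2 (S k)).
  - rewrite (sigma_equiv _ _ (s_bang _ _ _)). now rewrite IHcau_term.
  - rewrite (sigma_equiv _ _ (s_trail _ _ _)). now rewrite IHcau_term.
  - rewrite (sigma_equiv _ _ (s_iota _ _)). apply equiv_Iota; auto.
Qed.

Lemma sub1_msubst1 M N : cau_term M -> cau_term N ->
  equiv_sigmatau (sub1 M N) (msubst1 M N).
Proof. exact (Sub_liftn_Scons M N 0). Qed.

(** * Closure of the terms of the calculus without explicit substitutions *)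

(* Plain [inversion] is stuck on [ix n], which is not a constructor form. *)
Lemma cau_term_inv M : cau_term M ->
  match M with
  | Lam M => cau_term M
  | App M N | Let M N => cau_term M /\ cau_term N
  | Bang q M | Trail q M => tl_free q /\ cau_term M
  | Iota th => forall i, cau_term (th i)
  | Sub M s => M = One /\ exists n, s = ups n
  | Er _ => False
  | One => True
  end.
Proof. intros [[|n]| | | | | |]; simpl; eauto. Qed.

Lemma cau_fill F A B : cau_fctx F -> cau_term (fill F A) ->
  cau_term A /\ (cau_term B -> cau_term (fill F B)).
Proof.
  intro HF; induction HF; simpl; intro H; auto;
    apply cau_term_inv in H; simpl in H;
    try (destruct H as [H1 H2]);
    try (destruct IHHF; [assumption|]; split; [assumption|];
         constructor; auto; fail).
  destruct IHHF as [HA HB].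
  - specialize (H i). now rewrite upd_same in H.
  - split; [assumption|]. constructor.
    (* Nothing is known of [th i], which the hole overwrites. *)
    eapply upd_pred_replace; eauto.
Qed.

Lemma cau_inspect q th :
  tl_free q -> (forall i, cau_term (th i)) -> cau_term (inspect q th).
Proof.
  intros Hq Hth; induction Hq; simpl; auto; repeat (apply ct_app; auto).
Qed.

Lemma cau_beta_contr M N : cau_term M -> beta_contr M N -> cau_term N.
Proof.
  intros HM HMN; destruct HMN; apply cau_term_inv in HM; destruct HM as [H1 H2].
  - apply cau_term_inv in H1.
    constructor; [constructor|]. now apply cau_msubst.
  - apply cau_term_inv in H1 as [].
    constructor; [constructor|]. apply cau_msubst; [assumption|].
    now constructor.
  - constructor; [assumption|].
    destruct (cau_fill F (Iota th) (Trail Qti (inspect q th)) H H2) as [HA HB].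
    apply HB. constructor; [constructor|].
    apply cau_inspect; [assumption|]. exact (cau_term_inv _ HA).
Qed.

Lemma cau_beta M N : cau_term M -> beta M N -> cau_term N.
Proof.
  intros HM HMN; induction HMN; [now apply (cau_beta_contr M)|..];
    apply cau_term_inv in HM; simpl in HM; try (destruct HM as [HM1 HM2]);
    try (constructor; auto; fail).
  constructor. apply upd_pred; auto.
Qed.

(** * Preservation under tau-reduction *)

Lemma tl_free_tau_trail q q' : tl_free q -> tau_trail q q' -> tl_free q'.
Proof.
  intros Hq H; destruct H;
    repeat match goal with
    | H : tl_free (_ _) |- _ => inversion H; subst; clear H
    end; repeat constructor; auto.
Qed.

(** Terms and substitutions occur in a trail only below [Qtl], so [RM] and [RS] can be arbitrary. *)
Lemma tl_free_cl_tau RM RS q q' :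
  tl_free q -> cl_trail RM tau_trail RS q q' -> tl_free q'.
Proof.
  intros Hq H; induction H; [now apply (tl_free_tau_trail q)|..];
    inversion Hq; subst; constructor; auto.
  apply upd_pred; auto.
Qed.

Lemma cau_tau_term M N : cau_term M -> tau_term M N -> cau_term N.
Proof.
  intros HM H; destruct H; apply cau_term_inv in HM; simpl in HM.
  1-8: repeat match goal with
       | H : _ /\ _ |- _ => destruct H
       | H : cau_term (Trail _ _) |- _ => apply cau_term_inv in H; simpl in H
       end; repeat constructor; assumption.
  pose proof (HM i) as Hi. rewrite upd_same in Hi.
  apply cau_term_inv in Hi as [Hq Hi].
  constructor; constructor.
  - apply upd_pred; [constructor|assumption].
  (* [HM] concerns an update of [th]; writing [th] as its own update at [i] makes the two
     comparable. *)
  - rewrite <- (upd_id th i). eapply upd_pred_replace; eauto.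
Qed.

(** The substitution of an index contains no term, and tau has no rule on substitutions. *)
Lemma ups_cl_tau_normal n s : ~ cl_subst tau_term tau_trail (fun _ _ => False) (ups n) s.
Proof.
  revert s; induction n as [|n IH]; intros s H; inversion H; subst; auto.
  - match goal with H : cl_subst _ _ _ Sup _ |- _ => now inversion H end.
  - eapply IH; eassumption.
Qed.

Lemma cau_tau M N : cau_term M -> tau M N -> cau_term N.
Proof.
  intros HM H; unfold tau in H.
  induction H; [now apply (cau_tau_term M)|..];
    apply cau_term_inv in HM; simpl in HM;
    try (destruct HM as [HM1 HM2]);
    try (constructor; eauto using tl_free_cl_tau; fail).
  - constructor. apply upd_pred; auto.
  - subst M. inversion H as [? ? H0| | | | | | | | | | | | |]; inversion H0.
  - destruct HM2 as [n ->]. now apply ups_cl_tau_normal in H.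
  - contradiction.
Qed.

Lemma cau_step_cau M N : cau_term M -> cau_step M N -> cau_term N.
Proof.
  intros HM [P [HMP [HPN _]]]. apply (cau_beta _ _ HM) in HMP. clear HM.
  induction HPN; eauto using cau_tau.
Qed.

(** * Erasure and trail extraction on tau-normal terms *)

Definition head_trail (M : term) : Prop :=
  match M with Trail _ _ => True | _ => False end.

(** The first branch lifts a step of a subterm to its parent; the second turns a trail heading an
    immediate subterm into a tau-redex of the parent. *)
Ltac normal_sub :=
  match goal with
  | H : normal tau _ |- normal tau _ =>
      let y := fresh in let Hy := fresh in
      intros y Hy; eapply H; constructor; exact Hy
  | H : normal tau (?f ?A) |- ~ head_trail _ =>
      match goal with |- ~ head_trail ?X =>
        destruct X; simpl; auto; intros _; eapply H; apply c_base; constructor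
      end
  end.

Lemma normal_Iota th i :
  normal tau (Iota th) -> normal tau (th i) /\ ~ head_trail (th i).
Proof.
  intro H; split.
  - intros y Hy. eapply H. apply c_iota; exact Hy.
  - destruct (th i) as [| | | | |q M| | |] eqn:e; simpl; auto; intros _.
    (* If [th i] is [Trail q M], then [th] is the update of [upd th i M] that [t_iota] contracts. *)
    pose proof (t_iota q (upd th i M) i) as Ht.
    rewrite upd_same, upd_upd, <- e, upd_id in Ht.
    eapply H. apply c_base; exact Ht.
Qed.

(** Normality forbids a trail directly below any constructor, [~ head_trail M] forbids one at the
    root, and erasure stops at a bang. *)
Lemma normal_Er M : cau_term M -> normal tau M -> ~ head_trail M ->
  equiv_sigmatau (Er M) M.
Proof.
  intro H; induction H; intros Hn Hh.
  - destruct n; apply sigma_equiv; constructor.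
  - rewrite (sigma_equiv _ _ (s_er_lam _)), IHcau_term; [reflexivity|normal_sub..].
  - rewrite (sigma_equiv _ _ (s_er_app _ _)), IHcau_term1, IHcau_term2;
      [reflexivity|normal_sub..].
  - rewrite (sigma_equiv _ _ (s_er_let _ _)), IHcau_term1, IHcau_term2;
      [reflexivity|normal_sub..].
  - apply sigma_equiv, s_er_bang.
  - now destruct Hh.
  - rewrite (sigma_equiv _ _ (s_er_iota _)). apply equiv_Iota.
    intro i. destruct (normal_Iota th i Hn). auto.
Qed.

(** Each constructor yields a trail constructor over copies of [Qr], which tau collapses. As an
    equivalence this would not feed [nf_of] in [Beta_inspect]. *)
Lemma normal_Qtl M : cau_term M -> normal tau M -> ~ head_trail M ->
  clos_refl_trans trail sigmatau_q (Qtl M) Qr.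
Proof.
  intro H; induction H; intros Hn Hh.
  - destruct n; apply sigma_trail_rt; constructor.
  - eapply rt_trans; [apply sigma_trail_rt, s_tl_lam|].
    eapply rt_trans; [|apply tau_trail_rt, t_lam_r].
    apply (clos_rt_map sigmatau_q sigmatau_q Qlam); [now constructor|].
    apply IHcau_term; normal_sub.
  - eapply rt_trans; [apply sigma_trail_rt, s_tl_app|].
    eapply rt_trans; [|apply tau_trail_rt, t_app_r].
    eapply rt_trans.
    + apply (clos_rt_map sigmatau_q sigmatau_q (fun q => Qapp q _)); [now constructor|].
      apply IHcau_term1; normal_sub.
    + apply (clos_rt_map sigmatau_q sigmatau_q (Qapp Qr)); [now constructor|].
      apply IHcau_term2; normal_sub.
  - eapply rt_trans; [apply sigma_trail_rt, s_tl_let|].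
    eapply rt_trans; [|apply tau_trail_rt, t_let_r].
    eapply rt_trans.
    + apply (clos_rt_map sigmatau_q sigmatau_q (fun q => Qlet q _)); [now constructor|].
      apply IHcau_term1; normal_sub.
    + apply (clos_rt_map sigmatau_q sigmatau_q (Qlet Qr)); [now constructor|].
      apply IHcau_term2; normal_sub.
  - apply sigma_trail_rt, s_tl_bang.
  - now destruct Hh.
  - eapply rt_trans; [apply sigma_trail_rt, s_tl_iota|].
    eapply rt_trans; [|apply tau_trail_rt, t_tr_r].
    apply sigmatau_q_Qtr. intro i. destruct (normal_Iota th i Hn). auto.
Qed.

Lemma normal_Qtl_equiv M : cau_term M -> normal tau M -> ~ head_trail M ->
  equiv_q (Qtl M) Qr.
Proof.
  intros HM Hn Hh. apply clos_rt_clos_rst. now apply normal_Qtl.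
Qed.

(** Sigma rules on trails all fire at a [Qtl]. This makes the annotation of a bang in a tau-normal
    term normal for sigma as well. *)
Lemma tl_free_sigmatau_tau q q' : tl_free q -> sigmatau_q q q' ->
  cl_trail tau_term tau_trail (fun _ _ => False) q q'.
Proof.
  intros Hq H; unfold sigmatau_q in H.
  induction H as [q q' [H|H]| | | | | | | | |]; inversion Hq; subst;
    try (constructor; auto; fail); inversion H.
Qed.

(** * Simulation of one step *)

Lemma beta_contr_Beta M P : cau_term M -> normal tau M -> beta_contr M P ->
  exists P', Beta_contr M P' /\ equiv_sigmatau P' P.
Proof.
  intros HM Hn H; destruct H as [M N|q M N|q F th HF Hq];
    apply cau_term_inv in HM as [H1 H2].
  - apply cau_term_inv in H1; simpl in H1.
    assert (Hn1 : normal tau (Lam M)) by normal_sub.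
    (* Here and below, [clear] leaves [normal_sub] the normality of the parent term only. *)
    assert (HnM : normal tau M) by (clear Hn; normal_sub).
    assert (HhM : ~ head_trail M) by (clear Hn HnM; normal_sub).
    assert (HnN : normal tau N) by (clear Hn1 HnM; normal_sub).
    assert (HhN : ~ head_trail N) by (clear Hn1 HnM HnN; normal_sub).
    eexists; split; [constructor|]. unfold sub1.
    rewrite !normal_Er, !normal_Qtl_equiv by assumption.
    rewrite (tau_trail_equiv _ _ t_lam_r), (tau_trail_equiv _ _ t_app_r).
    rewrite (tau_trail_equiv _ _ (t_r_t _)).
    now rewrite <- sub1_msubst1.
  - apply cau_term_inv in H1; simpl in H1.
    assert (HnN : normal tau N) by normal_sub.
    assert (HhN : ~ head_trail N) by (clear HnN; normal_sub).
    eexists; split; [constructor|]. unfold sub1.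
    (* Only [N] is erased and extracted: [Beta_let] substitutes [Trail q M] as it stands. *)
    rewrite !normal_Er, !normal_Qtl_equiv by assumption.
    rewrite (tau_trail_equiv _ _ t_let_r), (tau_trail_equiv _ _ (t_r_t _)).
    rewrite <- sub1_msubst1; [reflexivity|assumption|].
    now constructor.
  (* The inspected trail is [q] itself: the extracted trail reduces to [Qr], then [t_t_r] removes
     it. Both contractions yield the same term. *)
  - eexists; split; [|reflexivity]. constructor; [|assumption]. split.
    + eapply rt_trans; [|apply tau_trail_rt, t_t_r].
      apply (clos_rt_map sigmatau_q sigmatau_q (Qt q)); [now constructor|].
      apply normal_Qtl; [assumption|normal_sub..].
    (* A step of [q] would be a tau-step, hence a step of the normal term [Bang q _]. *)
    + intros q' Hq'. apply (tl_free_sigmatau_tau _ _ Hq) in Hq'.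
      eapply Hn. apply c_bangq; exact Hq'.
Qed.

Lemma beta_Beta M P : cau_term M -> normal tau M -> beta M P ->
  exists P', Beta M P' /\ equiv_sigmatau P' P.
Proof.
  intros HM Hn H; induction H as [M P H| | | | | | | |th i P H IH].
  2-8: apply cau_term_inv in HM; simpl in HM; try destruct HM as [HM1 HM2];
    destruct IHbeta as [P' [H1 H2]]; [assumption|normal_sub|];
    eexists; split; [constructor; exact H1|now rewrite H2].
  - destruct (beta_contr_Beta M P HM Hn H) as [P' [H1 H2]].
    exists P'; split; [now constructor|assumption].
  - apply cau_term_inv in HM.
    destruct IH as [P' [H1 H2]]; [apply HM|apply normal_Iota, Hn|].
    eexists; split; [apply B_iota; exact H1|].
    apply equiv_Iota. intro j. unfold upd.
    destruct (tcon_eq_dec j i); [assumption|reflexivity].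
Qed.

(** A [Beta] step, then a single equivalence step that absorbs both the extra trails and
    substitutions and the final tau-normalisation. *)
Lemma cau_step_caus M N : cau_term M -> normal tau M -> cau_step M N ->
  clos_refl_trans term caus_step M N.
Proof.
  intros HM Hn [P [HMP [HPN _]]].
  destruct (beta_Beta M P HM Hn HMP) as [P' [H1 H2]].
  eapply rt_trans; [apply rt_step; left; exact H1|].
  apply rt_step; right. unfold equiv_sigmatau in *.
  eapply rst_trans; [exact H2|]. apply clos_rt_clos_rst.
  exact (clos_rt_monotone _ _ tau_sigmatau _ _ HPN).
Qed.

Theorem theorem2 (M N : term) (hM : cau_term M) (hN : cau_term N)
  (hnf : normal tau M) :
  clos_refl_trans term cau_step M N -> clos_refl_trans term caus_step M N.
Proof.
  intro H. apply clos_rt_rt1n in H. clear hN.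
  induction H as [M|M P N HMP HPN IH]; [apply rt_refl|].
  eapply rt_trans; [now apply cau_step_caus; [..|exact HMP]|].
  apply IH; [now apply (cau_step_cau M)|].
  (* A [cau_step] ends in a tau-normal form, so the normality assumed of the first term passes along
     the sequence. *)
  destruct HMP as [? [_ [_ HP]]]; exact HP.
Qed.
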